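(* Let $\mathcal{H}$ be a complex Hilbert space and $n\ge 1$. For all $x_1,x_2,\dots,x_n\in\mathcal{H}$, $$\frac{1}{\sqrt{n!}}\,\|x_1\|\,\|x_2\|\cdots\|x_n\|\le\|x_1\odot x_2\odot\cdots\odot x_n\|.$$
   Context: For $x_1,\dots,x_n\in\mathcal{H}$, the symmetric tensor is $x_1\odot\cdots\odot x_n=\frac1{n!}\sum_{\pi\in\Sigma_n}x_{\pi(1)}\otimes\cdots\otimes x_{\pi(n)}$, an element of the Hilbert space tensor power $\mathcal{H}^{\otimes n}$ with its usual norm; $\Sigma_n$ is the group of permutations of $\{1,\dots,n\}$. *)

(* Defs.v *)
From HB Require Import structures.
From mathcomp Require Import all_boot all_fingroup all_order all_algebra.
From mathcomp Require Import sesquilinear complex.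
From mathcomp Require Import boolp classical_sets functions topology normedtype.
From mathcomp Require Import reals ring.

Set Implicit Arguments.
Unset Strict Implicit.
Unset Printing Implicit Defensive.

Import Order.TTheory GRing.Theory Num.Theory.
Import numFieldNormedType.Exports.

Local Open Scope classical_set_scope.
Local Open Scope complex_scope.
Local Open Scope ring_scope.

(* Inner products are linear in the first argument and conjugate-linear in
   the second.  Norms of a normed module over R[i] are R[i]-valued, hence so
   is the inequality between norms; z <= w in R[i] means that w - z is a
   nonnegative real number. *)
HB.mixin Record CompleteNormedModule_isHilbert (R : realType) H
    of CompleteNormedModule R[i] H := {
  hdot : {dot H for (@Num.conj R[i])} ;
  hdot_norm : forall x : H, hdot x x = `|x| ^+ 2
}.

#[short(type="hilbertType")]
HB.structure Definition Hilbert (R : realType) :=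
  { H of CompleteNormedModule R[i] H & CompleteNormedModule_isHilbert R H }.

(* A realization of the Hilbert space tensor power of order n: the completion
   of the span of the elementary tensors x_1 (x) ... (x) x_n, with
   <x_1 (x) ... (x) x_n, y_1 (x) ... (x) y_n> = \prod_i <x_i, y_i>.  These
   data determine the Hilbert space up to a unique unitary map that preserves
   elementary tensors; hilbertTensorPower_exists below shows that they exist
   for every H and n. *)
Record hilbertTensorPower (R : realType) (H : hilbertType R) (n : nat) := {
  htp_space :> hilbertType R ;
  htensor : ('I_n -> H) -> htp_space ;
  htensor_multilinear : forall (x : 'I_n -> H) (i : 'I_n) (a : R[i]) (u v : H),
    htensor [eta x with i |-> a *: u + v] =
    a *: htensor [eta x with i |-> u] + htensor [eta x with i |-> v] ;
  hdot_htensor : forall x y : 'I_n -> H,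
    hdot (htensor x) (htensor y) = \prod_(i < n) hdot (x i) (y i) ;
  htensor_total : closure [set z : htp_space |
    exists (m : nat) (c : 'I_m -> R[i]) (x : 'I_m -> 'I_n -> H),
      z = \sum_(k < m) c k *: htensor (x k)] = setT
}.

Definition symtensor (R : realType) (H : hilbertType R) (n : nat)
    (T : hilbertTensorPower H n) (x : 'I_n -> H) : T :=
  (n`!%:R)^-1 *: \sum_(s : 'S_n) htensor T (fun i => x (s i)).

Module TensorPowerExistence.

Lemma ler_epsP (C : numFieldType) (x y M : C) : 0 <= M -> 
  x \is Num.real -> y \is Num.real ->
  (forall e, 0 < e -> x <= y + M * e) -> x <= y.
Proof.
move=> M0 xr yr h; rewrite real_leNgt//; apply/negP => yx.
have d0 : 0 < (x - y) / (M + 1) / 2.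
  by rewrite !divr_gt0 ?subr_gt0// ltr_wpDl.
have M1 : 0 < M + 1 by rewrite ltr_wpDl.
have := h _ d0; rewrite -lerBlDl; apply/negP.
rewrite -real_ltNge; first last.
- by rewrite rpredB.
- by rewrite ger0_real// mulr_ge0// ltW.
set a := x - y. have a0 : 0 < a by rewrite subr_gt0.
have -> : M * (a / (M + 1) / 2) = M * a / (2 * (M + 1)).
  by field; rewrite (gt_eqF M1).
rewrite ltr_pdivrMr ?mulr_gt0// -subr_gt0.
have -> : a * (2 * (M + 1)) - M * a = a * M + 2 * a by ring.
by rewrite ltr_wpDl ?mulr_gt0 ?mulr_ge0// ltW.
Qed.

Lemma eq0_eps (C : numFieldType) (x M : C) : 0 <= M ->
  (forall e, 0 < e -> `|x| <= M * e) -> x = 0.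
Proof.
move=> M0 h; apply/eqP; rewrite -normr_le0.
apply: (@ler_epsP _ _ _ M) => //; first exact: normr_real.
by move=> e /h; rewrite add0r.
Qed.

(* The scalar core of the Cauchy-Schwarz inequality for semi-inner products. *)
Lemma psd2 (C : numClosedFieldType) (a b c : C) : 0 <= a -> 0 <= c ->
  (forall l : C, 0 <= a + l^* * b + l * b^* + l * l^* * c) ->
  `|b| ^+ 2 <= a * c.
Proof.
move=> a0 c0 h; have [c1|c1] := eqVneq c 0; last first.
  have cr : c^* = c by rewrite geC0_conj.
  have cp : 0 < c by rewrite lt_def c1.
  have := h (- b / c); rewrite rmorphM rmorphN fmorphV/= cr.
  have -> : a + - b^* / c * b + - b / c * b^* + - b / c * (- b^* / c) * c =
      a - b * b^* / c by field.
  by rewrite -normCK subr_ge0 ler_pdivrMr.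
rewrite c1 mulr0; move: h; rewrite c1 => h.
suff -> : b = 0 by rewrite normr0 expr0n.
apply/eqP/negPn/negP => b0.
have nb : 0 < `|b| ^+ 2 by rewrite exprn_gt0// normr_gt0.
have := h (- ((a + 1) / 2 / `|b| ^+ 2) * b).
have tr : ((a + 1) / 2 / `|b| ^+ 2)^* = (a + 1) / 2 / `|b| ^+ 2.
  by rewrite geC0_conj// !divr_ge0// ?ltW// ltr_wpDl.
rewrite rmorphM rmorphN /= tr mulr0 addr0 !mulNr -!mulrA [b^* * b]mulrC -normCK.
rewrite mulVf ?gt_eqF// mulr1 -addrA -opprD -splitr opprD addrA subrr add0r.
by rewrite oppr_ge0 ler10.
Qed.

Section C_cauchy.
Variable R : realType.
Local Notation C := R[i].
Local Notation Re := (@complex.Re R).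
Local Notation Im := (@complex.Im R).

Lemma R_cauchy (B : C -> set R) :
  (forall e, 0 < e -> exists x, B e x) ->
  (forall e d x y, 0 < e -> 0 < d -> B e x -> B d y -> `|x - y|%:C <= e + d) ->
  exists z : R, forall e x, 0 < e -> B e x -> `|x - z|%:C <= e.
Proof.
move=> Bne Bc.
pose S := [set r | exists e x, [/\ 0 < e, B e x & r = x - Re e]].
have ReE (e : C) : 0 < e -> e = (Re e)%:C.
  by move=> e0; rewrite RRe_real// gtr0_real.
have key e x d y : 0 < e -> B e x -> 0 < d -> B d y -> y - Re d <= x + Re e.
  move=> e0 Be d0 Bd; have := Bc _ _ _ _ e0 d0 Be Bd.
  rewrite (ReE e)// (ReE d)//= -rmorphD/= lecR distrC => /ler_normlP[_].
  by rewrite lerBlDr addrC addrA -lerBlDr [x + _]addrC.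
have Sne : S !=set0.
  have [x Bx] := Bne 1 ltr01; by exists (x - Re 1); exists 1, x.
have Sub e x : 0 < e -> B e x -> ubound S (x + Re e).
  by move=> e0 Bx _ [d [y [d0 By ->]]]; exact: key.
have Shs : has_sup S.
  by split => //; have [x Bx] := Bne 1 ltr01; exists (x + Re 1); exact: Sub.
exists (sup S) => e x e0 Bx.
rewrite (ReE e)// lecR ler_distlC; apply/andP; split.
  by apply: sup_upper_bound => //; exists e, x.
by apply: ge_sup => //; exact: Sub.
Qed.

Lemma C_cauchy (B : C -> set C) :
  (forall e, 0 < e -> exists x, B e x) ->
  (forall e d x y, 0 < e -> 0 < d -> B e x -> B d y -> `|x - y| <= e + d) ->
  exists z : C, forall e x, 0 < e -> B e x -> `|x - z| <= e.
Proof.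
move=> Bne Bc.
have [a ha] : exists z : R, forall e x, 0 < e -> (Re @` B e) x -> `|x - z|%:C <= e.
  apply: R_cauchy => [e /Bne[x Bx]|e d _ _ e0 d0 [x Bx <-] [y By <-]].
    by exists (Re x), x.
  apply: le_trans (Bc _ _ _ _ e0 d0 Bx By).
  by apply: le_trans (normc_ge_Re _); rewrite raddfB.
have [b hb] : exists z : R, forall e x, 0 < e -> (Im @` B e) x -> `|x - z|%:C <= e.
  apply: R_cauchy => [e /Bne[x Bx]|e d _ _ e0 d0 [x Bx <-] [y By <-]].
    by exists (Im x), x.
  apply: le_trans (Bc _ _ _ _ e0 d0 Bx By).
  have -> : `|x - y| = `|(x - y) * - 'i%C|.
    have i1 : `|'i%C : C| = 1.
      by rewrite normc_def/= expr0n/= add0r expr1n sqrtr1.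
    by rewrite normrM normrN i1 mulr1.
  apply: le_trans (normc_ge_Re _).
  by rewrite mulrN raddfN/= ReiNIm opprK raddfB.
exists (a +i* b).
have coarse e x : 0 < e -> B e x -> `|x - (a +i* b)| <= 2 * e.
  move=> e0 Bx; have -> : x - (a +i* b) = (Re x - a)%:C + 'i%C * (Im x - b)%:C.
    by rewrite [LHS]complexE; case: (x) => ? ?.
  apply: le_trans (ler_normD _ _) _; rewrite mulr_natl mulr2n; apply: lerD.
    have -> : `|(Re x - a)%:C| = `|Re x - a|%:C.
      by rewrite normc_def/= expr0n/= addr0 sqrtr_sqr.
    by apply: ha => //; exists x.
  rewrite normrM; have -> : `|'i%C : C| = 1.
    by rewrite normc_def/= expr0n/= add0r expr1n sqrtr1.
  rewrite mul1r; have -> : `|(Im x - b)%:C| = `|Im x - b|%:C.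
    by rewrite normc_def/= expr0n/= addr0 sqrtr_sqr.
  by apply: hb => //; exists x.
move=> e x e0 Bx; apply: (@ler_epsP _ _ _ 3) => //; [exact: normr_real|exact: gtr0_real|].
move=> d d0; have [y By] := Bne d d0.
have -> : x - (a +i* b) = (x - y) + (y - (a +i* b)) by rewrite addrA subrK.
apply: le_trans (ler_normD _ _) _.
have -> : e + 3 * d = (e + d) + 2 * d.
  by rewrite -addrA -{2}[d]mul1r -mulrDl -natr1 [1 + _]addrC.
by apply: lerD; [exact: Bc | exact: coarse].
Qed.

End C_cauchy.

(* The reproducing kernel Hilbert space of a positive definite kernel k on X,
   as a space of functions on X.  A formal combination s : seq (C * X) stands
   for the function ks s = \sum_(p <- s) p.1 * k(p.2, _), Q is the inner
   product of two such combinations and N the norm; bnd f M says that the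
   functional ev f has norm at most M, and the space consists of the limits
   of the functions ks s for that norm. *)
Record pdkernel (R : realType) (X : Type) := PDKernel {
  pdk :> X -> X -> R[i] ;
  pdk_herm : forall x y, pdk y x = (pdk x y)^* ;
  pdk_ge0 : forall s : seq (R[i] * X),
    0 <= \sum_(p <- s) \sum_(q <- s) p.1 * q.1^* * pdk p.2 q.2
}.

Section RKHS.
Variables (R : realType) (X : Type) (k : pdkernel R X).
Local Notation C := R[i].
Local Notation F := (X -> C^o).
Local Notation S := (seq (C * X)).

Definition ev (f : F) (s : S) : C := \sum_(p <- s) p.1^* * f p.2.
Definition ks (s : S) : F := fun y => \sum_(p <- s) p.1 * k p.2 y.
Definition Q (s t : S) : C := ev (ks s) t.
Definition sc (a : C) (s : S) : S := [seq (a * p.1, p.2) | p <- s].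

Lemma ev_cat f s t : ev f (s ++ t) = ev f s + ev f t.
Proof. by rewrite /ev big_cat. Qed.
Lemma ev_sc f a s : ev f (sc a s) = a^* * ev f s.
Proof.
rewrite /ev big_map big_distrr; apply: eq_bigr => p _ /=.
by rewrite rmorphM mulrA.
Qed.
Lemma evD f g s : ev (f + g) s = ev f s + ev g s.
Proof.
rewrite /ev -big_split; apply: eq_bigr => p _ /=.
by rewrite -mulrDr.
Qed.
Lemma evZ a f s : ev (a *: f) s = a * ev f s.
Proof.
rewrite /ev big_distrr; apply: eq_bigr => p _ /=.
by rewrite mulrCA.
Qed.
Lemma evN f s : ev (- f) s = - ev f s.
Proof. by rewrite -scaleN1r evZ mulN1r. Qed.
Lemma evB f g s : ev (f - g) s = ev f s - ev g s.
Proof. by rewrite evD evN. Qed.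
Lemma ks_cat s t : ks (s ++ t) = ks s + ks t.
Proof. by apply/funext => y; rewrite /ks big_cat. Qed.
Lemma ks_sc a s : ks (sc a s) = a *: ks s.
Proof.
apply/funext => y; rewrite /ks big_map [RHS]big_distrr; apply: eq_bigr => p _ /=.
by rewrite mulrA.
Qed.
Lemma ks_nil : ks [::] = 0.
Proof. by apply/funext => y; rewrite /ks big_nil. Qed.

Lemma QE s t : Q s t = \sum_(p <- s) \sum_(q <- t) p.1 * q.1^* * k p.2 q.2.
Proof.
rewrite /Q /ev exchange_big; apply: eq_bigr => q _ /=; rewrite big_distrr.
by apply: eq_bigr => p _ /=; rewrite mulrA [q.1^* * _]mulrC.
Qed.
Lemma Q_ge0 s : 0 <= Q s s. Proof. by rewrite QE; exact: pdk_ge0. Qed.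
Lemma QC s t : Q t s = (Q s t)^*.
Proof.
rewrite !QE exchange_big rmorph_sum; apply: eq_bigr => p _.
rewrite rmorph_sum; apply: eq_bigr => q _ /=.
by rewrite !rmorphM/= conjCK pdk_herm [_ * q.1]mulrC.
Qed.

Definition N s := sqrtC (Q s s).
Lemma N_ge0 s : 0 <= N s. Proof. by rewrite sqrtC_ge0 Q_ge0. Qed.
Lemma sqN s : N s ^+ 2 = Q s s. Proof. exact: sqrtCK. Qed.

Lemma Q_CS s t : `|Q s t| <= N s * N t.
Proof.
rewrite -(@ler_pXn2r _ 2)// ?nnegrE ?mulr_ge0 ?N_ge0//.
rewrite exprMn !sqN; apply: psd2; rewrite ?Q_ge0// => l.
have := Q_ge0 (s ++ sc l t); rewrite /Q ks_cat ks_sc ev_cat ev_sc !evD !evZ.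
rewrite -!/(Q _ _) (QC s t).
set z := (X in 0 <= X); set w := (X in _ -> 0 <= X).
by have -> : z = w by rewrite /z /w; ring.
Qed.

Definition bnd (f : F) (M : C) := forall t, `|ev f t| <= M * N t.
Definition inK (f : F) := forall e, 0 < e -> exists s, bnd (f - ks s) e.

Lemma bnd_ks s : bnd (ks s) (N s). Proof. by move=> t; exact: Q_CS. Qed.
Lemma bndD f g a b : bnd f a -> bnd g b -> bnd (f + g) (a + b).
Proof.
move=> fa gb t; rewrite evD mulrDl; apply: le_trans (ler_normD _ _) _.
exact: lerD.
Qed.
Lemma bndZ c f a : bnd f a -> bnd (c *: f) (`|c| * a).
Proof. by move=> fa t; rewrite evZ normrM -mulrA ler_wpM2l. Qed.
Lemma bndN f a : bnd f a -> bnd (- f) a.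
Proof. by move=> fa t; rewrite evN normrN. Qed.
Lemma bndB f g a b : bnd f a -> bnd g b -> bnd (f - g) (a + b).
Proof. by move=> fa gb; apply/bndD/bndN. Qed.
Lemma bnd_le f a b : a <= b -> bnd f a -> bnd f b.
Proof. by move=> ab fa t; apply: le_trans (fa t) _; rewrite ler_wpM2r// N_ge0. Qed.
Lemma bnd_N s M : bnd (ks s) M -> 0 <= M -> N s <= M.
Proof.
move=> /(_ s) + M0; rewrite -/(Q s s) ger0_norm ?Q_ge0// -sqN expr2.
have [->|n0] := eqVneq (N s) 0; first by [].
by rewrite ler_pM2r// lt_def n0 N_ge0.
Qed.

Lemma inK_bnd f : inK f -> exists2 M, 0 <= M & bnd f M.
Proof.
move=> /(_ 1 ltr01)[s hs]; exists (1 + N s); first by rewrite addr_ge0// N_ge0.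
by rewrite -[f](subrK (ks s)); apply: bndD => //; exact: bnd_ks.
Qed.
Lemma inK_ks s : inK (ks s).
Proof.
move=> e e0; exists s => t; rewrite subrr /ev big1 => [|p _]; last by rewrite mulr0.
by rewrite normr0 mulr_ge0 ?N_ge0 ?ltW.
Qed.
Lemma inK_lin a f g : inK f -> inK g -> inK (a *: f + g).
Proof.
move=> fK gK e e0.
have a1 : 0 < `|a| + 1 by rewrite ltr_wpDl.
have [s hs] := fK _ (divr_gt0 (divr_gt0 e0 (ltr0Sn _ 1)) a1 : 0 < e / 2 / (`|a| + 1)).
have [t ht] := gK _ (divr_gt0 e0 (ltr0Sn _ 1) : 0 < e / 2).
exists (sc a s ++ t); rewrite ks_cat ks_sc.
have -> : a *: f + g - (a *: ks s + ks t) = a *: (f - ks s) + (g - ks t).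
  by rewrite scalerBr opprD addrACA.
rewrite [e]splitr; apply: bndD => //.
apply: bnd_le (bndZ a hs).
rewrite mulrCA ler_piMr// ?divr_ge0 ?ltW//.
by rewrite ltr_pdivrMr// mul1r ltr_pwDr.
Qed.

Lemma dot_ex f g : inK f -> inK g -> exists z : C,
  exists2 M, 0 <= M & forall e s, 0 < e -> bnd (g - ks s) e -> `|z - ev f s| <= M * e.
Proof.
move=> /inK_bnd[M M0 fM] gK; have M1 : 0 < M + 1 by rewrite ltr_wpDl.
pose B e := [set ev f s | s in [set s | bnd (g - ks s) (e / (M + 1))]].
have [||z hz] := @C_cauchy R B.
- by move=> e e0; have [s hs] := gK _ (divr_gt0 e0 M1); exists (ev f s), s.
- move=> e d _ _ e0 d0 [s hs <-] [t ht <-].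
  have -> : ev f s - ev f t = ev f (s ++ sc (-1) t).
    by rewrite ev_cat ev_sc rmorphN rmorph1 mulN1r.
  apply: le_trans (fM _) _.
  have Nst : N (s ++ sc (-1) t) <= (e + d) / (M + 1).
    apply: bnd_N; last by rewrite divr_ge0 ?addr_ge0// ltW.
    have -> : ks (s ++ sc (-1) t) = (g - ks t) - (g - ks s).
      by rewrite ks_cat ks_sc scaleN1r opprB [RHS]addrC subrKA.
    by rewrite [e + d]addrC mulrDl; exact: bndB.
  apply: le_trans (ler_wpM2l M0 Nst) _.
  rewrite mulrCA ler_piMr ?addr_ge0 ?ltW//.
  by rewrite ltr_pdivrMr// mul1r ltr_pwDr.
exists z, (M + 1); first exact: ltW.
move=> e s e0 hs; rewrite distrC; apply: hz; first exact: mulr_gt0.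
by exists s => //=; rewrite mulrAC divff ?mul1r// gt_eqF.
Qed.


Definition predK : {pred F} := [pred f : F | `[< inK f >]].
Lemma predKP (f : F) : reflect (inK f) (f \in predK).
Proof. exact: asboolP. Qed.
Lemma predK_submod : submod_closed predK.
Proof.
split=> [|a f g].
  by apply/predKP; have := inK_ks [::]; rewrite ks_nil.
by move=> /predKP fK /predKP gK; apply/predKP; exact: inK_lin.
Qed.
HB.instance Definition _ := GRing.isSubmodClosed.Build C F predK predK_submod.

Record K := MkK { fK :> F ; KP : fK \in predK }.
HB.instance Definition _ := [isSub for fK].
HB.instance Definition _ := gen_eqMixin K.
HB.instance Definition _ := gen_choiceMixin K.
HB.instance Definition _ := [SubChoice_isSubLmodule of K by <:].

Implicit Types f g h : K.
Lemma inKP f : inK f. Proof. exact/predKP/KP. Qed.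
Lemma mkKP (f : F) : inK f -> f \in predK. Proof. by move/predKP. Qed.
Lemma fKD f g : fK (f + g) = fK f + fK g. Proof. by []. Qed.
Lemma fKZ a f : fK (a *: f) = a *: fK f. Proof. by []. Qed.
Lemma fKB f g : fK (f - g) = fK f - fK g. Proof. by []. Qed.

Definition kK s : K := MkK (mkKP (inK_ks s)).

Definition dotK f g : C := projT1 (cid (dot_ex (inKP f) (inKP g))).
Lemma dotKP f g : exists2 M, 0 <= M &
  forall e s, 0 < e -> bnd (fK g - ks s) e -> `|dotK f g - ev f s| <= M * e.
Proof. by rewrite /dotK; case: cid. Qed.

Lemma dotK_ks f s : dotK f (kK s) = ev f s.
Proof.
have [M M0 h] := dotKP f (kK s); apply/eqP; rewrite -subr_eq0; apply/eqP.
apply: (eq0_eps M0) => e e0; apply: h => // t.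
by rewrite subrr -[0]ks_nil; apply: (bnd_le (ltW e0) _) => {}t; 
  rewrite /ev big1 ?normr0 ?mulr_ge0 ?N_ge0// => p _; rewrite ks_nil mulr0.
Qed.

Lemma dotK_linl a f g h : dotK (a *: f + g) h = a * dotK f h + dotK g h.
Proof.
have [M1 M10 h1] := dotKP (a *: f + g) h.
have [M2 M20 h2] := dotKP f h.
have [M3 M30 h3] := dotKP g h.
apply/eqP; rewrite -subr_eq0; apply/eqP.
apply: (@eq0_eps _ _ (M1 + (`|a| * M2 + M3))) => [|e e0].
  by rewrite !(addr_ge0, mulr_ge0).
have [s hs] := inKP h e0.
have -> : dotK (a *: f + g) h - (a * dotK f h + dotK g h) =
    (dotK (a *: f + g) h - ev (a *: f + g) s)
    - (a * (dotK f h - ev f s) + (dotK g h - ev g s)).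
  by rewrite fKD fKZ evD evZ; ring.
apply: le_trans (ler_normB _ _) _; rewrite mulrDl lerD ?h1//.
apply: le_trans (ler_normD _ _) _; rewrite mulrDl lerD ?h3//.
by rewrite normrM -mulrA ler_wpM2l// h2.
Qed.

Lemma dotK_Q f g : exists2 M, 0 <= M & forall e s t, 0 < e <= 1 ->
  bnd (fK f - ks s) e -> bnd (fK g - ks t) e -> `|dotK f g - Q s t| <= M * e.
Proof.
have [M M0 hM] := dotKP f g; have [A A0 hA] := inK_bnd (inKP g).
exists (M + (A + 1)); first by rewrite !addr_ge0.
move=> e s t /andP[e0 e1] hs ht.
have -> : dotK f g - Q s t = (dotK f g - ev f t) + ev (fK f - ks s) t.
  by rewrite (evB f (ks s) t) /Q; ring.
apply: le_trans (ler_normD _ _) _; rewrite mulrDl lerD ?hM//.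
apply: le_trans (hs t) _; rewrite mulrC ler_wpM2r ?(ltW e0)//.
apply: bnd_N; last by rewrite addr_ge0.
have -> : ks t = fK g - (fK g - ks t) by rewrite opprB addrC subrK.
by apply: bndB => //; apply: bnd_le ht.
Qed.

Lemma eps_min (e : C) : 0 < e -> exists2 d, 0 < d <= 1 & d <= e.
Proof.
move=> e0; have [e1|e1] := real_leP (gtr0_real e0) (@real1 C).
  by exists e; rewrite ?e0.
by exists 1; rewrite ?ltr01 ?lexx// ltW.
Qed.

Lemma dotKC f g : dotK g f = (dotK f g)^*.
Proof.
have [M M0 hM] := dotK_Q f g; have [A A0 hA] := dotK_Q g f.
apply/eqP; rewrite -subr_eq0; apply/eqP.
apply: (@eq0_eps _ _ (A + M)) => [|e /eps_min[d d01 de]]; first by rewrite addr_ge0.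
have d0 : 0 < d by case/andP: d01.
have [s hs] := inKP f d0; have [t ht] := inKP g d0.
have -> : dotK g f - (dotK f g)^* = (dotK g f - Q t s) - (dotK f g - Q s t)^*.
  by rewrite rmorphB /= (QC s t); ring.
apply: (@le_trans _ _ ((A + M) * d)); last by rewrite ler_wpM2l// addr_ge0.
apply: le_trans (ler_normB _ _) _; rewrite norm_conjC mulrDl.
by apply: lerD; [exact: hA|exact: hM].
Qed.

Lemma dotK_linr a f g h : dotK h (a *: f + g) = a^* * dotK h f + dotK h g.
Proof. by rewrite dotKC dotK_linl rmorphD rmorphM/= -!dotKC. Qed.

Lemma dotK_ge0 f : 0 <= dotK f f.
Proof.
have fr : dotK f f \is Num.real by apply/CrealP; rewrite -dotKC.
have [M M0 hM] := dotK_Q f f.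
apply: (@ler_epsP _ _ _ M) => // e /eps_min[d d01 de].
have d0 : 0 < d by case/andP: d01.
have [s hs] := inKP f d0.
have := hM _ _ _ d01 hs hs; rewrite real_ler_norml; last first.
  by rewrite rpredB// ger0_real// Q_ge0.
move=> /andP[+ _]; rewrite lerBrDr addrC lerBlDr => /(le_trans (Q_ge0 s)).
by move=> /le_trans; apply; rewrite lerD2l ler_wpM2l.
Qed.

Lemma dotK_CS f g : `|dotK f g| ^+ 2 <= dotK f f * dotK g g.
Proof.
apply: psd2; rewrite ?dotK_ge0// => l.
have := dotK_ge0 (l *: g + f); rewrite dotK_linl !dotK_linr (dotKC f g).
set z := (X in 0 <= X); set w := (X in _ -> 0 <= X).
by have -> : z = w by rewrite /z /w; ring.
Qed.

Definition nK f : C := sqrtC (dotK f f).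
Lemma nK_ge0 f : 0 <= nK f. Proof. by rewrite sqrtC_ge0 dotK_ge0. Qed.
Lemma sqnK f : nK f ^+ 2 = dotK f f. Proof. exact: sqrtCK. Qed.
Lemma nK_CS f g : `|dotK f g| <= nK f * nK g.
Proof.
rewrite -(@ler_pXn2r _ 2)// ?nnegrE ?mulr_ge0 ?nK_ge0//.
by rewrite exprMn !sqnK dotK_CS.
Qed.

Lemma nK_bnd f : bnd f (nK f).
Proof.
move=> t; rewrite -dotK_ks; apply: le_trans (nK_CS _ _) _.
by rewrite /nK /N dotK_ks.
Qed.

Lemma bnd_nK f M : 0 <= M -> bnd f M -> nK f <= M.
Proof.
move=> M0 fM; rewrite -(@ler_pXn2r _ 2)// ?nnegrE ?nK_ge0// sqnK expr2.
have [A A0 hA] := dotKP f f.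
apply: (@ler_epsP _ _ _ (A + M)); rewrite ?addr_ge0 ?ger0_real ?dotK_ge0 ?mulr_ge0//.
move=> e e0; have [s hs] := inKP f e0.
rewrite -[leLHS](subrK (ev f s)).
have Ns : N s <= M + e.
  apply: bnd_N; last by rewrite addr_ge0// ltW.
  have -> : ks s = fK f - (fK f - ks s) by rewrite opprB addrC subrK.
  exact: bndB.
rewrite -[leLHS]ger0_norm ?subrK ?dotK_ge0// -[X in `|X|](subrK (ev f s)).
apply: le_trans (ler_normD _ _) _.
have -> : M * M + (A + M) * e = A * e + M * (M + e) by ring.
by apply: lerD; [exact: hA | apply: le_trans (fM s) _; rewrite ler_wpM2l].
Qed.

Lemma nK_triangle f g : nK (f + g) <= nK f + nK g.
Proof.
by apply: bnd_nK; rewrite ?addr_ge0 ?nK_ge0//; apply: bndD; exact: nK_bnd.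
Qed.
Lemma dotK0l g : dotK 0 g = 0.
Proof. by have := dotK_linl (-1) 0 0 g; rewrite scaler0 addr0 mulN1r addNr. Qed.
Lemma nK_Z a f : nK (a *: f) = `|a| * nK f.
Proof.
have eZ g : a *: g = a *: g + 0 by rewrite addr0.
rewrite /nK {1}eZ dotK_linl dotK0l addr0 dotKC eZ dotK_linl dotK0l addr0.
rewrite rmorphM/= -dotKC mulrA -normCK sqrtCM ?nnegrE ?exprn_ge0 ?dotK_ge0//.
by rewrite sqrCK.
Qed.
Lemma nK_eq0 f : nK f = 0 -> f = 0.
Proof.
move=> f0; apply/val_inj/funext => x /=.
have := nK_bnd f [:: (1, x)]; rewrite f0 mul0r normr_le0 /ev big_seq1/= rmorph1 mul1r.
by move/eqP.
Qed.

HB.instance Definition _ := Lmodule_isNormed.Build C K nK_triangle nK_Z nK_eq0.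

Lemma nKE f : `|f| = nK f. Proof. by []. Qed.

Lemma K_complete (G : set_system K) : ProperFilter G -> cauchy G -> cvg G.
Proof.
move=> GG /cauchyP Gc.
have bndE f g e d : 0 < e -> 0 < d -> G (ball f e) -> G (ball g d) -> nK (f - g) <= e + d.
  move=> e0 d0 Gf Gg; have [h [fh gh]] := filter_ex (filterI Gf Gg).
  rewrite -nKE -[f](subrK h) -addrA; apply: le_trans (ler_normD _ _) _.
  move: fh gh; rewrite -!ball_normE/= => fh gh.
  by rewrite [`|h - g|]distrC lerD ?ltW.
pose c x : C := N [:: (1, x)] + 1.
have c0 x : 0 < c x by rewrite ltr_wpDl ?N_ge0.
have evx (f : F) x : ev f [:: (1, x)] = f x by rewrite /ev big_seq1 rmorph1 mul1r.
have lim x : exists z : C, forall e f, 0 < e -> G (ball f e) -> `|f x - z| <= e * c x.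
  pose B e := [set fK f x | f in [set f | G (ball f (e / c x))]].
  have [||z hz] := @C_cauchy R B.
  - by move=> e e0; have [f hf] := Gc _ (divr_gt0 e0 (c0 x)); exists (f x), f.
  - move=> e d _ _ e0 d0 [f Gf <-] [g Gg <-].
    have := nK_bnd (f - g) [:: (1, x)]; rewrite evx => /le_trans; apply.
    have := bndE _ _ _ _ (divr_gt0 e0 (c0 x)) (divr_gt0 d0 (c0 x)) Gf Gg.
    rewrite -mulrDl ler_pdivlMr// => /(le_trans _); apply.
    by rewrite ler_wpM2l ?nK_ge0// lerDl.
  exists z => e f e0 Gf; apply: hz; first exact: mulr_gt0.
  by exists f => //=; rewrite mulfK// gt_eqF.
pose l : F := fun x => projT1 (cid (lim x)).
have lP x e f : 0 < e -> G (ball f e) -> `|f x - l x| <= e * c x.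
  by rewrite /l; case: cid => z hz; exact: hz.
have bl e f : 0 < e -> G (ball f e) -> bnd (fK f - l) e.
  move=> e0 Gf t.
  pose A := \sum_(p <- t) `|p.1| * c p.2.
  have A0 : 0 <= A by rewrite sumr_ge0// => p _; rewrite mulr_ge0// ltW.
  apply: (@ler_epsP _ _ _ (N t + A)).
  - by rewrite addr_ge0// N_ge0.
  - exact: normr_real.
  - by rewrite ger0_real// mulr_ge0 ?N_ge0// ltW.
  move=> d d0; have [g Gg] := Gc _ d0.
  have -> : fK f - l = fK (f - g) + (fK g - l) by rewrite fKB addrA subrK.
  rewrite evD; apply: le_trans (ler_normD _ _) _.
  have -> : e * N t + (N t + A) * d = (e + d) * N t + A * d by ring.
  apply: lerD.
    apply: le_trans (nK_bnd _ _) _; rewrite ler_wpM2r ?N_ge0//.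
    exact: bndE.
  rewrite /ev; apply: le_trans (ler_norm_sum _ _ _) _; rewrite /A big_distrl.
  apply: ler_sum => p _ /=; rewrite normrM norm_conjC -mulrA ler_wpM2l// [c _ * _]mulrC.
  exact: lP.
have lK : inK l.
  move=> e e0; have e2 := divr_gt0 e0 (ltr0Sn _ 1).
  have [f Gf] := Gc _ e2; have [s hs] := inKP f e2; exists s.
  have -> : l - ks s = (fK f - ks s) - (fK f - l) by rewrite opprB [RHS]addrC subrKA.
  by rewrite [e]splitr; apply: bndB => //; exact: bl.
apply/cvg_ex; exists (MkK (mkKP lK)); apply/cvgrPdist_le => /= e e0.
have [f Gf] := Gc _ (divr_gt0 e0 (ltr0Sn _ 1)).
have fl : nK (f - MkK (mkKP lK)) <= e / 2.
  apply: bnd_nK; first by rewrite divr_ge0// ltW.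
  by apply: bl => //; rewrite divr_gt0.
apply: filterS Gf => g; rewrite -ball_normE/= => fg.
rewrite -[_ - g](subrKA f) [e]splitr; apply: le_trans (ler_normD _ _) _.
by apply: lerD; [rewrite distrC|exact: ltW].
Qed.

HB.instance Definition _ := Uniform_isComplete.Build K K_complete.

Lemma dotK_bilinear : bilinear_for
  (GRing.Scale.Law.clone _ _ *%R _) (GRing.Scale.Law.clone _ _ (Num.conj \; *%R) _) dotK.
Proof.
split=> [f a g h|f a g h] /=; [exact: dotK_linl | exact: dotK_linr].
Qed.
HB.instance Definition _ := bilinear_isBilinear.Build _ _ _ _ _ _ dotK dotK_bilinear.
Lemma dotK_herm f g : dotK f g = (-1) ^+ false * (dotK g f)^*.
Proof. by rewrite mul1r -dotKC. Qed.
HB.instance Definition _ := isHermitianSesquilinear.Build _ _ _ _ dotK dotK_herm.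
Lemma dotK_gt0 f : f != 0 -> 0 < dotK f f.
Proof.
move=> f0; rewrite lt_def dotK_ge0 andbT -sqnK sqrf_eq0.
by apply: contra f0 => /eqP/nK_eq0/eqP.
Qed.
HB.instance Definition _ := isDotProduct.Build _ _ dotK dotK_gt0.
Lemma dotK_norm f : (dotK : {dot K for _}) f f = `|f| ^+ 2.
Proof. by rewrite nKE sqnK. Qed.
HB.instance Definition _ := CompleteNormedModule_isHilbert.Build R K dotK_norm.
End RKHS.

Section Tensor.
Variables (R : realType) (H : hilbertType R).
Local Notation C := R[i].


Lemma hdotC (x y : H) : hdot y x = (hdot x y)^*.
Proof. by rewrite (hermC (@hdot R H) y x) mul1r. Qed.
Lemma hdot_ge0 (x : H) : 0 <= hdot x x.
Proof. by rewrite hdot_norm exprn_ge0. Qed.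

Definition psd (X : Type) (k : X -> X -> C) := forall m (c : 'I_m -> C) (x : 'I_m -> X),
  0 <= \sum_i \sum_j c i * (c j)^* * k (x i) (x j).

Lemma psd_mul_hdot (X : Type) (k : X -> X -> C) (phi : X -> H) : psd k ->
  psd (fun x y => k x y * hdot (phi x) (phi y)).
Proof.
move=> kpsd m c x.
suff gen (h : 'I_m -> H) : 0 <= \sum_i \sum_j c i * (c j)^* * (k (x i) (x j) * hdot (h i) (h j)).
  exact: gen.
have [n] := ubnP #|[pred i | h i != 0]|.
elim: n h => // n IH h hn.
have [/existsP[i0 hi0]|/existsPn h0] := boolP [exists i, h i != 0]; last first.
  rewrite sumr_ge0// => i _; rewrite sumr_ge0// => j _.
  by have := h0 i; rewrite negbK => /eqP ->; rewrite linear0l !mulr0.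
pose d := hdot (h i0) (h i0).
have d0 : 0 < d by rewrite neq0_dnorm_gt0.
have dr : d^* = d by rewrite geC0_conj// ltW.
pose l i := hdot (h i) (h i0) / d.
pose g i := h i - l i *: h i0.
have gE i j : hdot (h i) (h j) = l i * (l j)^* * d + hdot (g i) (g j).
  rewrite /g linearBl/= !linearBr/= linearZl_LR/= !linearZr_LR/= linearZl_LR/=.
  rewrite (hdotC (h j) (h i0)) -/d /l !rmorphM/= !fmorphV/= dr.
  by field; rewrite gt_eqF.
have -> : \sum_i \sum_j c i * (c j)^* * (k (x i) (x j) * hdot (h i) (h j)) =
  d * (\sum_i \sum_j (c i * l i) * (c j * l j)^* * k (x i) (x j)) +
  \sum_i \sum_j c i * (c j)^* * (k (x i) (x j) * hdot (g i) (g j)).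
  rewrite big_distrr -big_split; apply: eq_bigr => i _ /=.
  rewrite big_distrr -big_split; apply: eq_bigr => j _ /=.
  by rewrite gE !rmorphM/=; ring.
apply: addr_ge0; first by rewrite mulr_ge0 ?kpsd// ltW.
apply: IH; rewrite -ltnS; apply: leq_trans hn; rewrite ltnS; apply: proper_card.
apply/properP; split.
  apply/fintype.subsetP => i; rewrite !inE; apply: contra => /eqP hi.
  by rewrite /g /l hi linear0l mul0r scale0r subrr.
exists i0; rewrite !inE// negbK /g /l -/d divff ?gt_eqF//.
by rewrite scale1r subrr.
Qed.

Variable n : nat.
Notation X := ('I_n -> H).
Definition ktens (x y : X) : C := \prod_(i < n) hdot (x i) (y i).

Lemma psd_ktens : psd ktens.
Proof.
have gen (r : seq 'I_n) : psd (fun x y : X => \prod_(i <- r) hdot (x i) (y i)); last exact: gen.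
elim: r => [m c x|a r IH m c x].
  under eq_bigr do under eq_bigr do rewrite big_nil mulr1.
  under eq_bigr do rewrite -big_distrr/=.
  by rewrite -big_distrl/= -rmorph_sum -normCK exprn_ge0.
under eq_bigr do under eq_bigr do rewrite big_cons mulrC [hdot _ _ * _]mulrC mulrC.
exact: (psd_mul_hdot (fun x : X => x a) IH c x).
Qed.

Lemma ktens_herm x y : ktens y x = (ktens x y)^*.
Proof. by rewrite /ktens rmorph_prod; apply: eq_bigr => i _; exact: hdotC. Qed.

Lemma ktens_ge0 (s : seq (C * X)) :
  0 <= \sum_(p <- s) \sum_(q <- s) p.1 * q.1^* * ktens p.2 q.2.
Proof.
rewrite big_tnth; under eq_bigr do rewrite big_tnth.
exact: (psd_ktens (fun i => (tnth (in_tuple s) i).1) (fun i => (tnth (in_tuple s) i).2)).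
Qed.

Definition kT := PDKernel ktens_herm ktens_ge0.
Definition tens (x : X) : K kT := kK kT [:: (1, x)].

Lemma dot_tens x y : hdot (tens x) (tens y) = \prod_(i < n) hdot (x i) (y i).
Proof.
rewrite [LHS](dotK_ks (tens x)) /ev big_seq1 /= /ks big_seq1/=.
by rewrite conjC1 !mul1r.
Qed.

Lemma tensE x : fK (tens x) = ktens x :> (X -> C).
Proof. by apply/funext => y /=; rewrite /ks big_seq1 mul1r. Qed.

Lemma tens_multilinear (x : X) (i : 'I_n) (a : C) (u v : H) :
    tens [eta x with i |-> a *: u + v] =
    a *: tens [eta x with i |-> u] + tens [eta x with i |-> v].
Proof.
apply/val_inj/funext => y.
set x1 : X := [eta x with i |-> a *: u + v]; set x2 : X := [eta x with i |-> u].
set x3 : X := [eta x with i |-> v].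
change (fK (tens x1) y = a * fK (tens x2) y + fK (tens x3) y).
rewrite !tensE /x1 /x2 /x3.
have E w : ktens [eta x with i |-> w] y =
    hdot w (y i) * \prod_(j < n | j != i) hdot (x j) (y j).
  rewrite /ktens (bigD1 i)//= eqxx; congr (_ * _).
  by apply: eq_bigr => j /negPf ->.
by rewrite !E linearDl/= linearZl_LR/= mulrDl mulrA.
Qed.

Lemma tens_total : closure [set z : K kT |
    exists (m : nat) (c : 'I_m -> C) (x : 'I_m -> X),
      z = \sum_(k < m) c k *: tens (x k)] = setT.
Proof.
apply/seteqP; split => // f _ B /nbhs_ballP[e /= e0 fB].
have e2 := divr_gt0 e0 (ltr0Sn _ 1).
have [s hs] := inKP f e2.
exists (kK kT s); split.
  exists (size s), (fun i => (tnth (in_tuple s) i).1), (fun i => (tnth (in_tuple s) i).2).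
  apply/val_inj/funext => y /=.
  have -> : forall (I : Type) (r : seq I) (F : I -> K kT),
    fK (\sum_(i <- r) F i) = \sum_(i <- r) fK (F i).
    by move=> I r F; elim/big_ind2: _ => // *; rewrite fKD; congr (_ + _).
  rewrite fct_sumE /ks big_tnth; apply: eq_bigr => i _.
  by rewrite -[RHS]/(_ * fK (tens _) y) tensE.
apply: fB; rewrite -ball_normE/=; apply: (@le_lt_trans _ _ (e / 2)).
  by apply: (@bnd_nK _ _ _ (f - kK kT s)); rewrite ?ltW.
by rewrite gtr_pMr// invf_lt1 ?ltr1n.
Qed.

Definition tensorPower : hilbertTensorPower H n :=
  Build_hilbertTensorPower tens_multilinear dot_tens tens_total.
End Tensor.

End TensorPowerExistence.

Theorem hilbertTensorPower_exists (R : realType) (H : hilbertType R) (n : nat) :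
  inhabited (hilbertTensorPower H n).
Proof. exact: inhabits (TensorPowerExistence.tensorPower H n). Qed.

(* Main.v *)
Require Import Defs.
From HB Require Import structures.
From mathcomp Require Import all_boot all_fingroup all_order all_algebra.
From mathcomp Require Import sesquilinear complex.
From mathcomp Require Import boolp classical_sets topology normedtype reals.

(** The squared norm of x_1 (.) ... (.) x_n is 1/n! times the permanent of the
Gram matrix G = (<x_i, x_j>), so the claim is the inequality
per G >= \prod_i G_ii for a positive semidefinite matrix, a counterpart for
permanents of Hadamard's determinant inequality.

It follows by induction from per G >= G_aa * per (G without row and column a)
([gram_permanent_ge]).  In terms of creation and annihilation operators this
is the commutation relation c(x) c*(x) = |x|^2 + c*(x) c(x), whose second
summand is a positive operator.  Here the relation takes the form of an
expansion of the permanent along the column a ([gram_permanent_expand]): a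
permutation of A either fixes a, or is obtained from a permutation t of A \ a
and a point p of A \ a by inserting a between p and t p, i.e. by replacing
p |-> t p with p |-> a |-> t p.

The contribution of the second kind is nonnegative ([sum_offdiag_ge0]):
averaging it over all relabellings u of the rows makes it symmetric in the two
permutations u and t, and it becomes a sum over q of sesquilinear forms
\sum_(u, t) c u * (c t)^* * \prod_i <x_(u i), x_(t i)>.  Such forms are
nonnegative because products of Gram kernels are positive semidefinite
([sum_prod_hdot_ge0]).  The same averaging identifies the squared norm of the
symmetric tensor, a double sum over permutations, with the permanent
([norm_symtensor]). *)

Import Order.TTheory GRing.Theory Num.Theory.
Import numFieldNormedType.Exports.
Local Open Scope complex_scope.
Local Open Scope ring_scope.

Section GramPermanent.
Variables (R : realType) (H : hilbertType R).
Local Notation C := R[i].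

(** A kernel remains positive semidefinite when multiplied by a Gram kernel, and
the constant kernel 1 is positive semidefinite. *)
Lemma psd_prod_hdot (I : Type) (X : Type) (y : X -> I -> H) (r : seq I) :
  TensorPowerExistence.psd
    (fun u t : X => \prod_(i <- r) hdot (y u i) (y t i) : C).
Proof.
elim: r => [|a r IH] m c z.
  under eq_bigr do under eq_bigr do rewrite big_nil mulr1.
  under eq_bigr do rewrite -mulr_sumr.
  by rewrite -mulr_suml -rmorph_sum -normCK exprn_ge0.
under eq_bigr do under eq_bigr do rewrite big_cons [hdot _ _ * _]mulrC.
exact: (TensorPowerExistence.psd_mul_hdot (fun u => y u a) IH c z).
Qed.

Lemma sum_prod_hdot_ge0 (I : Type) (X : finType) (y : X -> I -> H)
    (r : seq I) (D : {set X}) (c : X -> C) :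
  0 <= \sum_(u in D) \sum_(t in D)
         c u * (c t)^* * \prod_(i <- r) hdot (y u i) (y t i).
Proof.
rewrite big_enum_val /=; under eq_bigr do rewrite big_enum_val /=.
exact: (@psd_prod_hdot _ _ y r _ (c \o enum_val) enum_val).
Qed.

Variables (I : finType) (x : I -> H).

(** The permanent of the principal submatrix of the Gram matrix on A.  Keeping
I fixed and letting A shrink makes the induction free of reindexing: the
permutations of A \ a are those of A that fix a. *)
Definition gram_permanent (A : {set I}) : C :=
  \sum_(s in Sym A) \prod_(i in A) hdot (x i) (x (s i)).

(** Relabelling the rows of a matrix does not change its permanent. *)
Lemma gram_permanent_translate (A : {set I}) (u : {perm I}) : u \in Sym A ->
  gram_permanent A =
  \sum_(t in Sym A) \prod_(i in A) hdot (x (u i)) (x (t i)).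
Proof.
move=> uA; rewrite [RHS](reindex_inj (mulgI u)) /=.
apply: eq_big => [t|t _]; first by rewrite groupMl.
rewrite (reindex_inj (@perm_inj _ u)) /=.
apply: eq_big => [i|i _]; last by rewrite permM.
by move: uA; rewrite inE => /perm_closed ->.
Qed.

(** The bijection behind the expansion along a: the product on the left sends
p to a and a to t p, so that removing a from its cycle leaves t. *)
Lemma Sym_tperm_mul (A : {set I}) (a p : I) (t : {perm I}) :
  a \in A -> p \in A ->
  (tperm a p * t \in Sym A)%g && ((tperm a p * t)%g p == a) =
  (t \in Sym (A :\ a)).
Proof.
move=> aA pA; rewrite groupMl; last first.
  rewrite inE; apply: fintype.subset_trans (tperm_on a p) _.
  by apply/fintype.subsetP => i; rewrite !inE => /orP[] /eqP ->.
rewrite permM tpermR !inE; apply/andP/idP => [[tA /eqP ta]|tB].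
  apply/fintype.subsetP => i ti; rewrite !inE (fintype.subsetP tA)// andbT.
  by apply: contra ti => /eqP ->; rewrite ta.
split; first by apply: fintype.subset_trans tB _; exact: finset.subD1set.
by rewrite (out_perm tB)// !inE eqxx.
Qed.

(** For u = 1 this is the term of the permanent for the permutation that
inserts a between q and t q; a general u relabels the rows. *)
Definition offdiag_term (a : I) (B : {set I}) (q : I) (u t : {perm I}) : C :=
  hdot (x (u q)) (x a) * hdot (x a) (x (t q)) *
  \prod_(i in B :\ q) hdot (x (u i)) (x (t i)).

Lemma gram_permanent_expand (A : {set I}) (a : I) : a \in A ->
  gram_permanent A =
  hdot (x a) (x a) * gram_permanent (A :\ a) +
  \sum_(p in A :\ a) \sum_(t in Sym (A :\ a)) offdiag_term a (A :\ a) p 1%g t.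
Proof.
move=> aA; rewrite /gram_permanent.
rewrite (partition_big (fun s : {perm I} => (s^-1)%g a) (mem A)) /=; last first.
  move=> s sA; have: (s^-1)%g \in Sym A by rewrite groupV.
  by rewrite inE => /perm_closed ->.
(* Each permutation s that sends p to a is written as tperm a p * t. *)
transitivity (\sum_(p in A) \sum_(t in Sym (A :\ a))
    \prod_(i in A) hdot (x i) (x ((tperm a p * t)%g i))).
  apply: eq_bigr => p pA; rewrite (reindex_inj (mulgI (tperm a p))) /=.
  apply: eq_bigl => t; rewrite -(Sym_tperm_mul _ _ _ t aA pA); congr (_ && _).
  set s := (tperm a p * t)%g.
  by apply/eqP/eqP => [<-|<-]; rewrite ?permKV ?permK.
rewrite (big_setD1 a aA) /=; congr (_ + _).
  rewrite mulr_sumr; apply: eq_bigr => t; rewrite inE => tB.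
  rewrite tperm1 mul1g (big_setD1 a aA) /=.
  by rewrite (out_perm tB)// !inE eqxx.
apply: eq_bigr => p pB; apply: eq_bigr => t; rewrite inE => tB.
rewrite (big_setD1 a aA) /= (big_setD1 p pB) /= /offdiag_term perm1.
have ta : t a = a by rewrite (out_perm tB)// !inE eqxx.
rewrite !permM tpermL tpermR ta mulrA.
congr (_ * _); first exact: mulrC.
apply: eq_bigr => i; rewrite !inE => /and3P[ip ia _].
by rewrite permM perm1 tpermD // eq_sym.
Qed.

Lemma sum_offdiag_translate (a : I) (B : {set I}) (u : {perm I}) :
  u \in Sym B ->
  \sum_(p in B) \sum_(t in Sym B) offdiag_term a B p 1%g t =
  \sum_(q in B) \sum_(t in Sym B) offdiag_term a B q u t.
Proof.
move=> uB; have uBP := uB; rewrite inE in uBP.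
rewrite (reindex_inj (@perm_inj _ u)) /=.
apply: eq_big => [q|q _]; first by rewrite (perm_closed _ uBP).
rewrite [RHS](reindex_inj (mulgI u)) /=.
apply: eq_big => [t|t _]; first by rewrite groupMl.
rewrite /offdiag_term perm1 permM; congr (_ * _).
rewrite (reindex_inj (@perm_inj _ u)) /=.
apply: eq_big => [i|i _]; last by rewrite perm1 permM.
by rewrite !inE (inj_eq perm_inj) (perm_closed _ uBP).
Qed.

(** Multiplying by #|Sym B| replaces the sum by its total over all row
relabellings u; for each q, the factors containing x a are then c u * (c t)^*
with c u = <x_(u q), x_a>. *)
Lemma sum_offdiag_ge0 (a : I) (B : {set I}) :
  0 <= \sum_(p in B) \sum_(t in Sym B) offdiag_term a B p 1%g t.
Proof.
have B0 : (0 : C) < #|Sym B|%:R by rewrite ltr0n cardG_gt0.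
rewrite -(pmulr_rge0 _ B0) mulr_natl -sumr_const.
under eq_bigr => u uB do rewrite (sum_offdiag_translate a B u uB).
rewrite exchange_big /=; apply: sumr_ge0 => q _.
have := sum_prod_hdot_ge0 _ _ (fun (u : {perm I}) i => x (u i))
  (enum (B :\ q)) (Sym B) (fun u => hdot (x (u q)) (x a)).
congr (0 <= _); apply: eq_bigr => u _; apply: eq_bigr => t _.
by rewrite /offdiag_term big_enum /= -TensorPowerExistence.hdotC.
Qed.

Lemma gram_permanent_ge (A : {set I}) :
  \prod_(i in A) hdot (x i) (x i) <= gram_permanent A.
Proof.
have [m] := ubnP #|A|; elim: m A => // m IH A.
have [->|[a aA]] := finset.set_0Vmem A => Am.
  rewrite big_set0 /gram_permanent (big_pred1 1%g) ?big_set0// => s.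
  rewrite !inE; apply/idP/eqP => [s0|->]; last exact: perm_on1.
  by apply/permP => i; rewrite (out_perm s0) ?inE ?perm1.
rewrite (gram_permanent_expand A a aA) (big_setD1 a aA) /= -[leLHS]addr0.
apply: lerD (sum_offdiag_ge0 _ _).
rewrite ler_wpM2l ?TensorPowerExistence.hdot_ge0// IH//.
by move: Am; rewrite (cardsD1 a) aA.
Qed.

End GramPermanent.
Arguments gram_permanent {R H I} x A.

(** Each of the n! inner sums over t in the double sum for the squared norm is
the permanent with its rows relabelled by s. *)
Lemma norm_symtensor (R : realType) (H : hilbertType R) (n : nat)
    (T : hilbertTensorPower H n) (x : 'I_n -> H) :
  `|symtensor T x| ^+ 2 = (n`!%:R)^-1 * gram_permanent x [set: 'I_n].
Proof.
have n0 : (n`!%:R : R[i]) != 0 by rewrite pnatr_eq0 -lt0n fact_gt0.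
have SymT : Sym [set: 'I_n] = [set: 'S_n].
  by apply/finset.setP => s; rewrite !inE; apply/fintype.subsetP => i; rewrite inE.
have sumSn (F : 'S_n -> R[i]) : \sum_s F s = \sum_(s in Sym [set: 'I_n]) F s.
  by apply: eq_bigl => s; rewrite SymT inE.
have permE (s : 'S_n) : \sum_(t : 'S_n) \prod_(i < n) hdot (x (s i)) (x (t i)) =
    gram_permanent x [set: 'I_n].
  rewrite (gram_permanent_translate _ _ _ x [set: 'I_n] s) ?SymT ?inE// -SymT.
  by rewrite sumSn; apply: eq_bigr => t _; apply: eq_bigl => i; rewrite inE.
rewrite -hdot_norm /symtensor linearZl_LR /= linearZr_LR /= linear_sumlz /=.
under eq_bigr do rewrite linear_sumr /=.
under eq_bigr => s _ do (under eq_bigr do rewrite hdot_htensor).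
under eq_bigr do rewrite permE.
rewrite sumSn sumr_const card_Sym cardsT card_ord.
by rewrite -[gram_permanent _ _ *+ _]mulr_natl fmorphV /= conjC_nat mulKf.
Qed.

Theorem proposition4p3 (R : realType) (H : hilbertType R) (n : nat)
    (n_ge1 : (1 <= n)%N) (T : hilbertTensorPower H n) (x : 'I_n -> H) :
  (sqrtC (n`!%:R : R[i]))^-1 * \prod_(i < n) `|x i| <= `|symtensor T x|.
Proof.
rewrite -(@ler_pXn2r _ 2)// ?nnegrE ?normr_ge0//; last first.
  by rewrite mulr_ge0 ?prodr_ge0 ?invr_ge0 ?sqrtC_ge0 ?ler0n.
rewrite norm_symtensor exprMn exprVn sqrtCK ler_wpM2l ?invr_ge0 ?ler0n//.
rewrite -prodrXl.
have := gram_permanent_ge _ _ _ x [set: 'I_n]; congr (_ <= _).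
by apply: eq_big => [i|i _]; rewrite ?inE ?hdot_norm.
Qed.
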